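(* For all ENR spaces $X$ and $Y$ (with base points), with wedge $X\vee Y$, $$\max\{TC(X),TC(Y),\mathrm{cat}(X\times Y)\}\le TC(X\vee Y)\le TC^M(X\vee Y)\le TC^M(X)+TC^M(Y)-1.$$
   Context: ENR means Euclidean neighborhood retract. For a space $X$, $PX=X^{[0,1]}$ is the space of all paths in $X$ and $\pi:PX\to X\times X$ is the fibration $\pi(f)=(f(0),f(1))$. $TC(X)$ is the minimal number $k$ such that $X\times X$ admits an open cover $U_1,\dots,U_k$ such that over each $U_i$ there is a continuous section $s_i:U_i\to PX$ of $\pi$. A section $s$ of $\pi$ over $U\subset X\times X$ is called reserved if $s(x,x)$ is the constant path at $x$ for every $(x,x)\in U$. $TC^M(X)$ (monoidal topological complexity) is the minimal $k$ such that $X\times X$ admits an open cover $U_1,\dots,U_k$ with continuous reserved sections $s_i:U_i\to PX$ of $\pi$. $\mathrm{cat}(X)$ is the (non-reduced) Lusternik-Schnirelmann category: the minimal number $k$ such that $X$ can be covered by $k$ open sets each contractible to a point in $X$. *)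

(* Defs.v *)
From HB Require Import structures.
From mathcomp Require Import all_boot all_order all_algebra.
From mathcomp Require Import all_classical all_reals all_analysis.
From mathcomp Require Import homotopy.
Set Implicit Arguments.
Unset Strict Implicit.
Unset Printing Implicit Defensive.
Import Order.TTheory GRing.Theory Num.Theory.
Import numFieldNormedType.Exports.
Local Open Scope classical_set_scope.
Local Open Scope ring_scope.

Section EuclideanNeighborhoodRetract.
Context (R : realType) (X : topologicalType).

Definition embedding (Y : topologicalType) (e : X -> Y) : Prop :=
  injective e /\
  (forall A : set X, open A <-> exists2 B : set Y, open B & e @^-1` B = A).

Definition retraction_onto (Y : topologicalType) (U A : set Y) (r : Y -> Y) :
    Prop :=
  [/\ A `<=` U, {within U, continuous r}, r @` U `<=` A &
      forall y, A y -> r y = y].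

Definition ENR : Prop :=
  exists (n : nat) (e : X -> 'rV[R]_n), embedding e /\
    exists (U : set 'rV[R]_n) (r : 'rV[R]_n -> 'rV[R]_n),
      open U /\ retraction_onto U (range e) r.

End EuclideanNeighborhoodRetract.

Definition unit_interval (R : realType) : topologicalType :=
  set_type (`[0, 1]%classic : set R).

Lemma unit_interval0_subproof (R : realType) :
  (0 : R) \in (`[0, 1]%classic : set R).
Proof. by apply: mem_set => /=; rewrite in_itv /= lexx ler01. Qed.

Lemma unit_interval1_subproof (R : realType) :
  (1 : R) \in (`[0, 1]%classic : set R).
Proof. by apply: mem_set => /=; rewrite in_itv /= lexx ler01. Qed.

Definition I0 (R : realType) : unit_interval R :=
  exist _ 0 (unit_interval0_subproof R).
Definition I1 (R : realType) : unit_interval R :=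
  exist _ 1 (unit_interval1_subproof R).

Definition path_space (R : realType) (X : topologicalType) : Type :=
  continuousType (unit_interval R) X.

HB.instance Definition _ (R : realType) (X : topologicalType) :=
  Choice.on (path_space R X).
HB.instance Definition _ (R : realType) (X : topologicalType) :=
  Topological.copy (path_space R X)
    (@initial_topology (path_space R X)
       {compact-open, unit_interval R -> X} (fun f => f)).

Definition path_ends (R : realType) (X : topologicalType)
    (f : path_space R X) : X * X :=
  (f (I0 R), f (I1 R)).

Definition section_over (R : realType) (X : topologicalType)
    (U : set (X * X)) (s : X * X -> path_space R X) : Prop :=
  {within U, continuous s} /\ (forall z, U z -> path_ends (s z) = z).

Definition reserved (R : realType) (X : topologicalType)
    (U : set (X * X)) (s : X * X -> path_space R X) : Prop :=
  forall x, U (x, x) -> forall t, s (x, x) t = x.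

Definition contractible_in (R : realType) (X : topologicalType) (U : set X) :
    Prop :=
  exists (x0 : X) (H : X * unit_interval R -> X),
    {within U `*` [set: unit_interval R], continuous H} /\
    (forall x, U x -> H (x, I0 R) = x /\ H (x, I1 R) = x0).

(* The infimum is over a set of natural numbers, hence is a minimum, unless
   there is no finite cover of the required kind, in which case it is +oo. *)
Definition covering_number (R : realType) (T : topologicalType)
    (P : set T -> Prop) : \bar R :=
  ereal_inf [set k%:R%:E | k in [set k : nat |
    exists U : 'I_k -> set T,
      (forall i, open (U i) /\ P (U i)) /\ \bigcup_i U i = [set: T]]].

Definition TC (R : realType) (X : topologicalType) : \bar R :=
  covering_number R (fun U : set (X * X) =>
    exists s : X * X -> path_space R X, section_over U s).

Definition TCM (R : realType) (X : topologicalType) : \bar R :=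
  covering_number R (fun U : set (X * X) =>
    exists s : X * X -> path_space R X, section_over U s /\ reserved U s).

Definition LScat (R : realType) (X : topologicalType) : \bar R :=
  covering_number R (@contractible_in R X).

Definition wedge2 (X Y : topologicalType) (x0 : X) (y0 : Y) : topologicalType :=
  @wedge bool (fun b => if b then X else Y)
    (fun b => if b return (if b then X else Y) then x0 else y0).

(* Main.v *)
Require Import Defs.
From HB Require Import structures.
From mathcomp Require Import all_boot all_order all_algebra.
From mathcomp Require Import all_classical all_reals all_analysis.
From mathcomp Require Import homotopy.
From mathcomp Require Import zify lra.
Set Implicit Arguments.
Unset Strict Implicit.
Unset Printing Implicit Defensive.
Import Order.TTheory GRing.Theory Num.Theory.
Import numFieldNormedType.Exports.
Local Open Scope classical_set_scope.
Local Open Scope ring_scope.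

(** Write Z for the wedge of X and Y, with its two retractions onto X and Y
    that collapse the other summand to the base point.

    Lower bounds.  Motion planning passes to retracts, by planning in the
    larger space and retracting the path.  For the category of the product,
    plan in Z a path f from a point x of X to a point y of Y: retracting f to X
    leads from x to x0, and retracting the reverse of f to Y leads from y to
    y0, so running both at once contracts a subset of the product to (x0, y0).
    The middle inequality is clear, reserved sections being sections.

    Upper bound.  The ENR hypothesis enters through an embedding in a Euclidean
    space, which makes every open subset of X * X the positivity set of a
    continuous function.  Start with n sets over X * X and m sets over Y * Y
    that carry reserved planners.  After a change near the base point all of
    them contain it.  A cover of multiplicity k by N such sets extends to one
    of multiplicity k + 1 by N + 1 such sets (multicover_extend), so there are
    covers of X * X and Y * Y by N = n + m - 1 sets each, of multiplicities m
    and n.  For any two points of Z, the pair of their retractions to X lies in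
    m or more sets and the pair of their retractions to Y in n or more; as N <
    n + m, some index i serves both (pigeonhole_sum).  Hence the N open subsets
    W_i of Z * Z, defined by asking that the retracted pairs lie in the i-th
    set on each side, cover Z * Z.

    On W_i the two given planners provide paths in X and in Y, that is, a path
    in X * Y between two points of the union of the axes, which is a copy of Z.
    It remains to keep this path on the axes.  If both ends are on the same
    axis, the other coordinate rests, as the planners are reserved.  Otherwise,
    the coordinate that has to return to its base point must run first.  This
    is achieved by delaying one coordinate by an amount in [0, 1] and the other
    by the complementary amount.  The delay is a continuous function of the
    ends except when both are the base point, where continuity of the motion
    holds because all the paths nearby are short. *)

Lemma continuous_pair_at (A B C : topologicalType) (f : A -> B) (g : A -> C) x :
  continuous_at x f -> continuous_at x g ->
  continuous_at x (fun y => (f y, g y)).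
Proof. by move=> cf cg; exact: (cvg_pair cf cg). Qed.

Lemma continuous_prod_map (A B C D : topologicalType) (f : A -> C)
    (g : B -> D) : continuous f -> continuous g ->
  continuous (fun z : A * B => (f z.1, g z.2)).
Proof.
move=> cf cg z; apply: continuous_pair_at.
  by apply: continuous_comp; [exact: cvg_fst|exact: cf].
by apply: continuous_comp; [exact: cvg_snd|exact: cg].
Qed.

(** * The unit interval *)

Section UnitInterval.
Context (R : realType).

Lemma clamp_subproof (x : R) :
  Num.max 0 (Num.min 1 x) \in (`[0, 1]%classic : set R).
Proof.
by apply: mem_set; rewrite /= in_itv /= le_max lexx ge_max ler01 ge_min lexx.
Qed.

Definition clamp (x : R) : unit_interval R :=
  exist (fun y : R => is_true (y \in (`[0, 1]%classic : set R))) _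
    (clamp_subproof x).

Lemma unit_interval_eq (s t : unit_interval R) : set_val s = set_val t -> s = t.
Proof. exact: val_inj. Qed.

Lemma set_val_clamp x : set_val (clamp x) = Num.max 0 (Num.min 1 x).
Proof. by rewrite set_valE. Qed.

Lemma clamp_le0 x : x <= 0 -> clamp x = I0 R.
Proof.
move=> x0; apply: unit_interval_eq; rewrite set_val_clamp set_valE /=.
by apply/max_idPl; rewrite ge_min x0 orbT.
Qed.

Lemma clamp_ge1 x : 1 <= x -> clamp x = I1 R.
Proof.
move=> x1; apply: unit_interval_eq; rewrite set_val_clamp set_valE /=.
by rewrite (min_idPl x1); apply/max_idPr.
Qed.

Lemma clampK (t : unit_interval R) : clamp (set_val t) = t.
Proof.
apply: unit_interval_eq; rewrite set_val_clamp.
have := set_valP t; rewrite /= in_itv /= => /andP[t0 t1].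
by rewrite (min_idPr t1) (max_idPr t0).
Qed.

Lemma clamp_continuous : continuous clamp.
Proof.
apply: continuous_comp_initial => x /=.
rewrite /comp.
under eq_fun do rewrite set_val_clamp.
apply: (@continuous_max R R (fun=> 0) (fun y => Num.min 1 y)).
  exact: cvg_cst.
apply: (@continuous_min R R (fun=> 1) id); first exact: cvg_cst.
exact: cvg_id.
Qed.

Lemma unit_interval_val_continuous :
  continuous (set_val : unit_interval R -> R).
Proof. exact: initial_continuous. Qed.

Lemma unit_interval_compact : compact [set: unit_interval R].
Proof.
have -> : [set: unit_interval R] = clamp @` `[0, 1]%classic.
  apply/esym/seteqP; split => // t _; exists (set_val t); last exact: clampK.
  exact: set_valP.
apply: continuous_compact; last exact: segment_compact.
exact/continuous_subspaceT/clamp_continuous.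
Qed.

Lemma unit_interval_regular : regular_space (unit_interval R).
Proof. exact: (@uniform_regular (set_type (`[0, 1]%classic : set R))). Qed.

Definition reverse_time (t : unit_interval R) := clamp (1 - set_val t).

Lemma reverse_time0 : reverse_time (I0 R) = I1 R.
Proof. by rewrite /reverse_time clamp_ge1// set_valE /= subr0. Qed.

Lemma reverse_time1 : reverse_time (I1 R) = I0 R.
Proof. by rewrite /reverse_time clamp_le0// set_valE /= subrr. Qed.

Lemma reverse_time_continuous : continuous reverse_time.
Proof.
move=> t; apply: (@continuous_comp (unit_interval R) R (unit_interval R)
  set_val (fun x => clamp (1 - x))).
  exact: unit_interval_val_continuous.
apply: (@continuous_comp _ _ _ (fun x : R => 1 - x) clamp).
  by apply: cvgB; [exact: cst_continuous|exact: cvg_id].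
exact: clamp_continuous.
Qed.

End UnitInterval.

(** * Currying of paths *)

Section Curry.
Context (R : realType) (T X : topologicalType).
Implicit Types (U : set T) (s : T -> path_space R X).

Lemma path_space_cvgP (F : set_system (path_space R X)) (f : path_space R X) :
  Filter F ->
  F --> f <-> forall K O, compact K -> open O -> f @` K `<=` O ->
    F [set g : path_space R X | g @` K `<=` O].
Proof.
move=> FF; split.
  move=> Ff K O cK oO fKO; apply: Ff.
  exists [set g : path_space R X | g @` K `<=` O]; split => //=.
  exists [set g : unit_interval R -> X | g @` K `<=` O] => //.
  exact: compact_open_open.
move=> H A [B [[C oC CB] Bf BA]].
apply: (filterS BA); rewrite -CB.
have /(_ C) : (fun g : path_space R X =>
    (g : {compact-open, unit_interval R -> X})) @ F
    --> (f : {compact-open, unit_interval R -> X}).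
  by apply/compact_open_cvgP => K O cK oO fKO; exact: H.
move=> FC; apply: FC; apply: open_nbhs_nbhs; split => //.
by move: Bf; rewrite -CB.
Qed.

(** Evaluation of paths is continuous because the unit interval is compact and
    regular: a small closed neighbourhood of the time is a compact set on which
    the compact-open topology controls the nearby paths. *)
Lemma path_section_uncurry U s : open U -> {within U, continuous s} ->
  forall z t, U z ->
    continuous_at (z, t) (fun p : T * unit_interval R => s p.1 p.2).
Proof.
move=> oU cs z t Uz O /=; rewrite nbhsE => -[B [oB Bst] BO].
have {}cs : continuous_at z s.
  by move: cs; rewrite continuous_open_subspace// => /(_ z (mem_set Uz)).
have [K Kt KO] : exists2 K, nbhs t K & closure K `<=` s z @^-1` B.
  have cz : continuous (s z : unit_interval R -> X) := @cts_fun _ _ (s z).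
  apply: unit_interval_regular; apply: cz; exact: open_nbhs_nbhs.
move/path_space_cvgP: cs => /(_ (closure K) B) cs.
have szK : nbhs z [set w | s w @` closure K `<=` B].
  apply: cs => //.
    apply: (subclosed_compact _ (@unit_interval_compact R)) => //.
    exact: closed_closure.
  by move=> _ [u Ku <-]; exact: KO.
exists ([set w | s w @` closure K `<=` B], K) => // -[w u] /= [wK Ku].
by apply: BO; apply: wK; exists u => //; exact: subset_closure.
Qed.

(** The point x0 only fills in the constant path outside U, where the partial
    maps of F need not be continuous. *)
Lemma path_section_curry U (x0 : X) (F : T * unit_interval R -> X) : open U ->
  (forall z t, U z -> continuous_at (z, t) F) ->
  exists s, {within U, continuous s} /\ forall z t, U z -> s z t = F (z, t).
Proof.
move=> oU cF.
have cFz z : U z -> continuous (fun t => F (z, t)).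
  move=> Uz t.
  have ct : continuous_at t (fun u : unit_interval R => (z, u)).
    by apply: continuous_pair_at; [exact: cst_continuous|exact: cvg_id].
  exact: (continuous_comp ct (cF z t Uz)).
have c0 : continuous (fun _ : unit_interval R => x0).
  exact: cst_continuous.
pose s z : path_space R X :=
  if pselect (U z) is left h then mkcts (cFz z h) else mkcts c0.
have sE z t : U z -> s z t = F (z, t).
  by rewrite /s; case: pselect.
exists s; split => //.
rewrite continuous_open_subspace// => z /set_mem Uz.
apply/path_space_cvgP => K O cK oO fKO.
suff : \forall w \near z, s w @` K `<=` O by [].
near=> w => y /= [+ + <-]; near: w.
move/compact_near_coveringP/near_covering_withinP : cK; apply.
move=> v Kv; have [[P Q] [Px Qv] PQfO] : nbhs (z, v) (F @^-1` O).
  apply: cF => //; apply: open_nbhs_nbhs; split => //.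
  by rewrite -sE//; apply: fKO; exists v.
exists (Q, P `&` U) => [|[b a] /= [Qb [Pa Ua]] Kb].
  by split => //=; apply: filterI => //; exact: open_nbhs_nbhs.
by rewrite sE//; exact: PQfO.
Unshelve. all: by end_near. Qed.

End Curry.

(** * Local motion planners *)

Section Planners.
Context (R : realType) (X : topologicalType).
Implicit Types (U : set (X * X)) (F : X * X * unit_interval R -> X).

(** Over an open set, continuity of a section of the path fibration is a
    condition at each point on the uncurried map, which is what is used from
    here on. *)
Definition planner_at F (z : X * X) : Prop :=
  [/\ forall t, continuous_at (z, t) F, F (z, I0 R) = z.1 & F (z, I1 R) = z.2].

Definition reserved_at F (z : X * X) : Prop :=
  z.1 = z.2 -> forall t, F (z, t) = z.1.

Lemma section_planner U (s : X * X -> path_space R X) :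
  open U -> section_over U s ->
  forall z, U z -> planner_at (fun p => s p.1 p.2) z.
Proof.
move=> oU [cs es] z Uz; have := es z Uz; rewrite /path_ends => szE.
split => [t||]; first exact: (path_section_uncurry oU cs).
  by rewrite -[in RHS]szE.
by rewrite -[in RHS]szE.
Qed.

Lemma planner_section (x0 : X) U F :
  open U -> (forall z, U z -> planner_at F z) ->
  exists s, section_over U s /\ forall z t, U z -> s z t = F (z, t).
Proof.
move=> oU UF.
have [|s [cs sE]] := @path_section_curry _ _ _ U x0 F oU.
  by move=> z t /UF[].
exists s; split=> //; split=> // z Uz; have [_ F0 F1] := UF z Uz.
by rewrite /path_ends !sE// F0 F1 -surjective_pairing.
Qed.

Definition has_reserved_planner U : Prop :=
  exists F, forall z, U z -> planner_at F z /\ reserved_at F z.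

Lemma reserved_section_planner U : open U ->
  (exists s : X * X -> path_space R X, section_over U s /\ reserved U s) ->
  has_reserved_planner U.
Proof.
move=> oU [s [ss rs]]; exists (fun p => s p.1 p.2) => z Uz; split.
  exact: section_planner ss z Uz.
by case: z Uz => x y Uxy; rewrite /reserved_at /= => xy t; subst y; rewrite rs.
Qed.

Lemma reserved_planner_section (x0 : X) U : open U ->
  has_reserved_planner U ->
  exists s : X * X -> path_space R X, section_over U s /\ reserved U s.
Proof.
move=> oU [F UF]; have [|s [ss sE]] := @planner_section x0 U F oU.
  by move=> z /UF[].
exists s; split => // x Uxx t; rewrite sE//.
by have [_ /(_ erefl t)] := UF _ Uxx.
Qed.

Lemma planner_at_near F G z :
  (\forall w \near z, forall t, F (w, t) = G (w, t)) ->
  planner_at F z -> planner_at G z.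
Proof.
move=> FG [cF F0 F1]; have FGz := nbhs_singleton FG.
split; rewrite -?FGz// => t A; rewrite -FGz => /(cF t) FA.
have FG2 : \forall p \near (z, t), F p = G p.
  exists ([set w | forall u, F (w, u) = G (w, u)], setT).
    by split => //=; exact: filterT.
  by move=> [w u] /= [].
suff : \forall p \near (z, t), A (G p) by [].
have {}FA : \forall p \near (z, t), A (F p) by [].
by apply: filterS2 FG2 FA => p ->.
Qed.

End Planners.

(** V (c z) is a set from which the structure over U is copied near z; as the
    choice c is locally constant on U, the copies never have to be compared. *)
Definition locally_glues (T : topologicalType) (P : set T -> Prop) : Prop :=
  forall (U : set T) (V : nat -> set T) (c : T -> nat),
    (forall z, U z -> P (V (c z)) /\
       \forall w \near z, V (c z) w /\ c w = c z) -> P U.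

Lemma reserved_planner_glues (R : realType) (X : topologicalType) :
  locally_glues (@has_reserved_planner R X).
Proof.
move=> U V c Uc.
have /choice[F HF] i : exists F : X * X * unit_interval R -> X,
    has_reserved_planner R (V i) ->
    forall z, V i z -> planner_at F z /\ reserved_at F z.
  have [[F HF]|nP] := pselect (has_reserved_planner R (V i)); first by exists F.
  by exists (fun p => p.1.1).
exists (fun p => F (c p.1) p) => z Uz; have [PV nV] := Uc z Uz.
have [Vz _] := nbhs_singleton nV; have [pF rF] := HF _ PV _ Vz; split => //.
by apply: planner_at_near pF; apply: filterS nV => w [_ cw] t /=; rewrite cw.
Qed.

(** * Covers of higher multiplicity *)

Section Multicovers.
Context (R : realType) (T : topologicalType) (P : set T -> Prop) (b : T).
Context (Pglue : locally_glues P).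
Context (opens_are_cozero : forall U : set T, open U ->
  exists2 f : T -> R, continuous f & forall z, U z <-> 0 < f z).
Implicit Types (U : nat -> set T) (n k : nat).

Definition multicover n k U : Prop :=
  (forall i, (i < n)%N -> [/\ open (U i), P (U i) & U i b]) /\
  (forall z, (k <= \sum_(i < n) `[< U i z >])%N).

Lemma open_superlevel (f : T -> R) a : continuous f -> open [set z | a < f z].
Proof.
move=> cf; apply: (open_comp (D := [set y | a < y])); last exact: open_gt.
by move=> z _; exact: cf.
Qed.

Lemma open_sublevel (f : T -> R) a : continuous f -> open [set z | f z < a].
Proof.
move=> cf; apply: (open_comp (D := [set y | y < a])); last exact: open_lt.
by move=> z _; exact: cf.
Qed.

(** Let U_0 be a set through b and f a function with positivity set U_0.  Each
    other U_i is cut down to f < f b / 2 and enlarged by the neighbourhood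
    f > f b / 2 of b, which is disjoint from it and lies in U_0.  The points
    with f = f b / 2 that are lost stay covered by U_0. *)
Lemma cover_through_base n U :
  (forall i, (i < n)%N -> open (U i) /\ P (U i)) ->
  (forall z, exists2 i, (i < n)%N & U i z) ->
  exists V, multicover n 1 V.
Proof.
move=> oPU covU.
have [i0 i0n Ub] := covU b.
have [oU0 PU0] := oPU i0 i0n.
have [f cf fP] := opens_are_cozero oU0.
have fb : 0 < f b by apply/fP.
have fb2 : 0 < f b / 2 by rewrite divr_gt0.
have bfb : f b / 2 < f b by lra.
pose V i := if i == i0 then U i0
  else [set z | f b / 2 < f z] `|` (U i `&` [set z | f z < f b / 2]).
have oV i : (i < n)%N -> open (V i).
  move=> /oPU[oUi _]; rewrite /V; case: ifP => // _.
  apply: openU; first exact: open_superlevel.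
  by apply: openI => //; exact: open_sublevel.
exists V; split => [i ni|z].
  split; first exact: oV; last by rewrite /V; case: ifP => // _; left.
  apply: (Pglue (V := U) (c := fun z => if f b / 2 < f z then i0 else i)).
  move=> z; rewrite /V; case: ifPn => [/eqP ->|_ [/= zb|[Uz /= zb]]].
  - rewrite if_same; split=> //.
    near=> w; rewrite if_same; split => //.
    by near: w; exact: open_nbhs_nbhs.
  - rewrite zb; split=> //; near=> w.
    have -> : f b / 2 < f w.
      near: w; apply: open_nbhs_nbhs; split => //; exact: open_superlevel.
    split => //; apply/fP; apply: (lt_trans fb2).
    near: w; apply: open_nbhs_nbhs; split => //; exact: open_superlevel.
  - rewrite ltNge (ltW zb) /=; have [oUi PUi] := oPU i ni; split => //.
    near=> w.
    have wb : f w < f b / 2.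
      near: w; apply: open_nbhs_nbhs; split => //; exact: open_sublevel.
    rewrite ltNge (ltW wb) /=; split => //.
    by near: w; exact: open_nbhs_nbhs.
have [i ni Vz] : exists2 i, (i < n)%N & V i z.
  have [zb|zb] := ltP 0 (f z).
    by exists i0 => //; rewrite /V eqxx; apply/fP.
  have [i ni Uz] := covU z; exists i => //.
  rewrite /V; case: ifPn => [/eqP <-//|_].
  by right; split => //=; exact: le_lt_trans fb2.
rewrite (bigD1 (Ordinal ni))//=.
by rewrite (asboolT Vz).
Unshelve. all: by end_near. Qed.

Lemma multicover_leq n k U : multicover n k U -> (k <= n)%N.
Proof.
move=> [_ /(_ b)] /leq_trans; apply.
rewrite -[X in (_ <= X)%N](card_ord n) -sum1_card.
by apply: leq_sum => i _; case: asboolP.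
Qed.

(** Choose functions f_i with positivity sets U_i.  For a set S of k indices let
    G S consist of the points where each f_i with i in S is positive and
    exceeds each f_j with j not in S.  For distinct S of the same size these
    open sets are disjoint, and G S is contained in every U_i with i in S; so
    the union of the G S carries the same structure as the U_i.  A point that
    lies in exactly k of the U_i lies in G S for the set S of these k indices,
    hence the union is the additional set.  Scaling the f_i to have distinct
    values at b makes b a point of it. *)
Lemma multicover_extend n k U : (0 < k)%N ->
  multicover n k U -> exists V, multicover n.+1 k.+1 V.
Proof.
move=> k0 mU; have kn := multicover_leq mU; case: mU => HU cU.
have /choice[f Hf] (i : nat) : exists f : T -> R, (i < n)%N ->
    [/\ continuous f, forall z, U i z <-> 0 < f z & f b = (n - i)%:R].
  have [ni|ni] := ltnP i n; last by exists (fun=> 0).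
  have [oU _ Ub] := HU i ni.
  have [f cf fP] := opens_are_cozero oU.
  have fb : 0 < f b by apply/fP.
  have d0 : 0 < (n - i)%:R / f b by rewrite divr_gt0// ltr0n subn_gt0.
  exists (fun z => (n - i)%:R / f b * f z) => _; split.
  - by move=> z; apply: cvgM; [exact: cst_continuous|exact: cf].
  - by move=> z; rewrite pmulr_rgt0//; exact: fP.
  - by rewrite divfK// gt_eqF.
pose G (S : {set 'I_n}) : set T := [set z | forall i : 'I_n, i \in S ->
  0 < f i z /\ forall j : 'I_n, j \notin S -> f j z < f i z].
have oG S : open (G S).
  rewrite openE => z Gz /=; apply: filter_forall => i.
  have [iS|iS] := boolP (i \in S); last by apply: nearW.
  have [fi0 fij] := Gz i iS; have [cfi _ _] := Hf i (ltn_ord i).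
  near=> w => _; split.
    near: w; apply: open_nbhs_nbhs; split => //; exact: open_superlevel.
  near: w; apply: filter_forall => j.
  have [jS|jS] := boolP (j \in S); first by apply: nearW.
  have [cfj _ _] := Hf j (ltn_ord j).
  have : 0 < f i z - f j z by rewrite subr_gt0; exact: fij.
  have /(@open_superlevel _ 0) oij : continuous (fun w => f i w - f j w).
    by move=> w; apply: cvgB; [exact: cfi|exact: cfj].
  move=> zij; have : \forall w \near z, 0 < f i w - f j w.
    by apply: open_nbhs_nbhs; split.
  by apply: filterS => w; rewrite subr_gt0.
have GI (S S' : {set 'I_n}) z : #|S| = #|S'| -> G S z -> G S' z -> S = S'.
  move=> SS' GSz GSz'; apply/eqP; rewrite eqEcard SS' leqnn andbT.
  apply/negPn/negP => nSS'.
  have nS'S : ~~ (S' \subset S).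
    apply: contra nSS' => S'S; have : S' == S by rewrite eqEcard S'S SS' leqnn.
    by move=> /eqP ->.
  have /subsetPn[i iS iS'] := nSS'; have /subsetPn[j jS' jS] := nS'S.
  have [_ /(_ j jS) ji] := GSz i iS; have [_ /(_ i iS') ij] := GSz' j jS'.
  by have := lt_trans ij ji; rewrite ltxx.
(* The additional member of the cover. *)
pose W : set T := [set z | exists S : {set 'I_n}, #|S| = k /\ G S z].
have oW : open W.
  have -> : W = \bigcup_(S in [set S : {set 'I_n} | #|S| = k]) G S.
    apply/seteqP; split => z [S]; first by case=> ? ?; exists S.
    by move=> ? ?; exists S.
  by apply: bigcup_open => S _.
(* On W the set S with z in G S is unique, so S, and with it a chosen index
   rep S in S, is locally constant. *)
pose col z : {set 'I_n} :=
  xget finset.set0 [set S : {set 'I_n} | #|S| = k /\ G S z].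
have colE (S : {set 'I_n}) z : #|S| = k -> G S z -> col z = S.
  move=> Sk GSz; apply: xget_unique => // S' [S'k GS'z].
  by apply: GI GS'z GSz; rewrite S'k.
pose rep (S : {set 'I_n}) : nat :=
  if [pick i in S] is Some i then val i else 0%N.
have repP (S : {set 'I_n}) : #|S| = k -> exists2 i : 'I_n, rep S = i & i \in S.
  move=> Sk; rewrite /rep; case: pickP => [i iS|S0]; first by exists i.
  by move: k0; rewrite -Sk (eq_card0 S0).
have PW : P W.
  apply: (Pglue (V := U) (c := rep \o col)) => z [S [Sk GSz]] /=.
  have [i ri iS] := repP S Sk; rewrite (colE S z Sk GSz) ri.
  have [_ PUi _] := HU i (ltn_ord i); split => //.
  near=> w.
  have GSw : G S w by near: w; apply: open_nbhs_nbhs.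
  rewrite (colE S w Sk GSw); split => //.
  have [_ fP _] := Hf i (ltn_ord i); apply/fP.
  by have [] := GSw i iS.
have Wb : W b.
  (* As f_i b = n - i, the k largest values at b are the first k ones. *)
  exists [set i : 'I_n | (i < k)%N]%SET; split.
    rewrite -sum1_card -[RHS]card_ord -sum1_card.
    rewrite (big_ord_widen n (fun=> 1%N) kn).
    by apply: eq_bigl => i; rewrite inE.
  move=> i; rewrite inE => ik; have [_ _ ->] := Hf i (ltn_ord i).
  split; first by rewrite ltr0n subn_gt0.
  move=> j; rewrite inE -leqNgt => kj; have [_ _ ->] := Hf j (ltn_ord j).
  by rewrite ltr_nat; have := ltn_ord j; lia.
exists (fun i => if (i < n)%N then U i else W); split => [i|z].
  by rewrite ltnS leq_eqVlt; case: ltnP => [/HU//|_ _].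
rewrite big_ord_recr /= ltnn.
under eq_bigr do rewrite ltn_ord.
have := cU z; rewrite leq_eqVlt => /predU1P[ck|ck]; last first.
  exact: leq_trans ck (leq_addr _ _).
suff Wz : W z by rewrite (asboolT Wz) -ck addn1.
exists [set i : 'I_n | `[< U i z >]]%SET; split.
  rewrite ck -sum1_card [RHS](bigID (fun i : 'I_n => `[< U i z >])) /=.
  rewrite [X in (_ + X)%N]big1 ?addn0; last by move=> i /negbTE ->.
  apply: eq_big => [i|i]; first by rewrite finset.inE.
  by rewrite finset.inE => ->.
move=> i; rewrite inE => /asboolP Uiz; have [_ fiP _] := Hf i (ltn_ord i).
split; first exact/fiP.
move=> j; rewrite inE => /asboolP Ujz; have [_ fjP _] := Hf j (ltn_ord j).
apply: le_lt_trans (iffLR (fiP z) Uiz); rewrite leNgt; apply/negP => fj.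
by apply: Ujz; apply/fjP.
Unshelve. all: by end_near. Qed.

Lemma multicover_exists n U m :
  (forall i, (i < n)%N -> open (U i) /\ P (U i)) ->
  (forall z, exists2 i, (i < n)%N & U i z) ->
  exists V, multicover (n + m) m.+1 V.
Proof.
move=> oPU covU; elim: m => [|m [V /(multicover_extend (ltn0Sn m))]].
  by rewrite addn0; exact: cover_through_base covU.
by rewrite addnS.
Qed.

End Multicovers.

(** * Open sets as positivity sets of functions *)

Section CozeroSets.
Context (R : realType).

(** The distance to the complement. *)
Lemma open_is_cozero (V : normedModType R) (B : set V) : open B ->
  exists2 f : V -> R, continuous f & forall z, B z <-> 0 < f z.
Proof.
move=> oB; have [CB0|/set0P[a0 Ca0]] := eqVneq (~` B) set0.
  exists (fun=> 1) => [|z]; first exact: cst_continuous.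
  split=> // _; apply: contrapT => nBz.
  by have : (~` B) z by []; rewrite CB0.
have dfin x : @edist_inf R V (~` B) x \is a fin_num.
  rewrite ge0_fin_numE ?edist_inf_ge0 //; apply: le_lt_trans.
    by apply: ereal_inf_lbound; exists a0.
  rewrite -ge0_fin_numE ?edist_ge0 //; apply/edist_finP.
  exists (`|x - a0| + 1) => /=; first by rewrite ltr_wpDl.
  by rewrite -ball_normE /ball_ /= ltrDl.
exists (fun z => fine (edist_inf (~` B) z)) => [z|z].
  by apply: fine_cvg; rewrite fineK//; exact: edist_inf_continuous.
split=> [Bz|].
  have /nbhs_ballP[r /= r0 rB] : nbhs z B by exact: open_nbhs_nbhs.
  rewrite -lte_fin fineK//; apply: (@lt_le_trans _ _ r%:E).
    by rewrite lte_fin.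
  apply: le_ereal_inf_tmp => _ [a Ca <-]; rewrite leNgt; apply/negP => zar.
  by apply: Ca; apply: rB; exact: (@edist_lt_ball _ _ _ (z, a)).
by apply: contraPP => nBz; rewrite edist_inf0//= ltxx.
Qed.

Lemma embedding_continuous (X V : topologicalType) (e : X -> V) :
  embedding e -> continuous e.
Proof.
by move=> [_ oe]; apply/continuousP => B oB; apply/oe; exists B.
Qed.

Lemma embedding_base_distance (X : topologicalType) (V : normedModType R)
    (e : X -> V) (x0 : X) : embedding e ->
  exists d : X -> R,
    [/\ continuous d, forall x, 0 <= d x & forall x, d x = 0 <-> x = x0].
Proof.
move=> emb; exists (fun x => `|e x - e x0|); split=> // [x|x].
  apply: cvg_norm; apply: cvgB; last exact: cst_continuous.
  exact: embedding_continuous.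
split=> [/eqP|->]; last by rewrite subrr normr0.
by rewrite normr_eq0 subr_eq0 => /eqP/(proj1 emb).
Qed.

Lemma embedding_square_cozero (X : topologicalType) (V : normedModType R)
    (e : X -> V) : embedding e ->
  forall U : set (X * X), open U ->
  exists2 f : X * X -> R, continuous f & forall z, U z <-> 0 < f z.
Proof.
move=> emb U oU; pose ee (z : X * X) : V * V := (e z.1, e z.2).
have ce := embedding_continuous emb.
have cee : continuous ee by exact: continuous_prod_map.
pose B := \bigcup_(A in [set A : set (V * V) | open A /\ ee @^-1` A `<=` U]) A.
have /open_is_cozero[f cf fP] : open B by apply: bigcup_open => A [].
exists (f \o ee) => [z|z].
  by apply: continuous_comp; [exact: cee|exact: cf].
rewrite /= -fP; split=> [Uz|[A [oA AU]]]; last exact: AU.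
have [[A1 A2] /= [nA1 nA2] AU] : nbhs z U by exact: open_nbhs_nbhs.
have nbhsE (A : set X) x : nbhs x A ->
    exists C : set V, [/\ open C, C (e x) & e @^-1` C `<=` A].
  rewrite nbhsE => -[_ [/(proj2 emb)[C oC <-] Cx] CA].
  by exists C.
have [C1 [oC1 C1z CA1]] := nbhsE _ _ nA1.
have [C2 [oC2 C2z CA2]] := nbhsE _ _ nA2.
exists (C1 `*` C2) => //; split.
  rewrite openE => -[v1 v2] [/= Cv1 Cv2]; exists (C1, C2) => //.
  by split; exact: open_nbhs_nbhs.
by move=> w [/= w1 w2]; apply: AU; split; [exact: CA1|exact: CA2].
Qed.

End CozeroSets.

(** * The wedge as the union of the axes of the product *)

Section Wedge.
Context (X Y : topologicalType) (x0 : X) (y0 : Y).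
Local Notation Z := (wedge2 x0 y0).

Let fam := fun b : bool => if b then X else Y.
Let pts : forall b : bool, fam b :=
  fun b => if b return (if b then X else Y) then x0 else y0.

Definition wedge_inl (x : X) : Z := @wedge_lift bool fam pts true x.
Definition wedge_inr (y : Y) : Z := @wedge_lift bool fam pts false y.

Definition wedge_rec (T : Type) (f : X -> T) (g : Y -> T) : Z -> T :=
  @wedge_fun bool fam pts T
    (fun b => if b return fam b -> T then f else g).

Lemma wedge_inl_continuous : continuous wedge_inl.
Proof. exact: (@wedge_lift_continuous bool fam pts true). Qed.

Lemma wedge_inr_continuous : continuous wedge_inr.
Proof. exact: (@wedge_lift_continuous bool fam pts false). Qed.

Lemma wedge_inl_base : wedge_inl x0 = wedge_inr y0.
Proof. exact: (@wedge_liftE bool fam pts false y0 true x0). Qed.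

Lemma wedge_cases (z : Z) :
  (exists x, z = wedge_inl x) \/ (exists y, z = wedge_inr y).
Proof.
have : [set: wedge pts] z by [].
by rewrite -wedgeTE => -[[] _ [p _ <-]]; [left|right]; exists p.
Qed.

Lemma wedge_rec_continuous (T : topologicalType) (f : X -> T) (g : Y -> T) :
  continuous f -> continuous g -> f x0 = g y0 -> continuous (wedge_rec f g).
Proof.
by move=> cf cg fg; apply: wedge_fun_continuous; [case|case; case].
Qed.

Lemma wedge_rec_inl (T : Type) (f : X -> T) (g : Y -> T) x :
  f x0 = g y0 -> wedge_rec f g (wedge_inl x) = f x.
Proof.
move=> fg; exact: (@wedge_lift_funE bool fam pts T
  (fun b => if b return fam b -> T then f else g) true x ltac:(by case; case)).
Qed.

Lemma wedge_rec_inr (T : Type) (f : X -> T) (g : Y -> T) y :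
  f x0 = g y0 -> wedge_rec f g (wedge_inr y) = g y.
Proof.
move=> fg; exact: (@wedge_lift_funE bool fam pts T
  (fun b => if b return fam b -> T then f else g) false y ltac:(by case; case)).
Qed.

Definition retl : Z -> X := wedge_rec id (fun=> x0).
Definition retr : Z -> Y := wedge_rec (fun=> y0) id.

Lemma retl_continuous : continuous retl.
Proof.
apply: wedge_rec_continuous => //; first by move=> x; exact: cvg_id.
exact: cst_continuous.
Qed.

Lemma retr_continuous : continuous retr.
Proof.
apply: wedge_rec_continuous => //; first exact: cst_continuous.
by move=> y; exact: cvg_id.
Qed.

Lemma retl_inl x : retl (wedge_inl x) = x.
Proof. exact: wedge_rec_inl. Qed.

Lemma retl_inr y : retl (wedge_inr y) = x0.
Proof. exact: wedge_rec_inr. Qed.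

Lemma retr_inl x : retr (wedge_inl x) = y0.
Proof. exact: wedge_rec_inl. Qed.

Lemma retr_inr y : retr (wedge_inr y) = y.
Proof. exact: wedge_rec_inr. Qed.

Definition retl2 (zw : Z * Z) : X * X := (retl zw.1, retl zw.2).
Definition retr2 (zw : Z * Z) : Y * Y := (retr zw.1, retr zw.2).

Lemma retl2_continuous : continuous retl2.
Proof. by apply: continuous_prod_map; exact: retl_continuous. Qed.

Lemma retr2_continuous : continuous retr2.
Proof. by apply: continuous_prod_map; exact: retr_continuous. Qed.

Definition wedge_domain (U : set (X * X)) (V : set (Y * Y)) : set (Z * Z) :=
  [set zw | U (retl2 zw) /\ V (retr2 zw)].

(** On the union of the axes this is the inverse of the embedding of the wedge
    in the product, made total. *)
Definition axes_glue (p : X * Y) : Z :=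
  if pselect (p.2 = y0) then wedge_inl p.1 else wedge_inr p.2.

Definition on_axes (p : X * Y) : Prop := p.1 = x0 \/ p.2 = y0.

Lemma axes_glueK z : axes_glue (retl z, retr z) = z.
Proof.
rewrite /axes_glue /=; case: pselect => /=;
  case: (wedge_cases z) => [[x ->]|[y ->]];
  rewrite ?retr_inl ?retr_inr ?retl_inl ?retl_inr//.
by move=> ->; exact: wedge_inl_base.
Qed.

Lemma axes_glue_inl x : axes_glue (x, y0) = wedge_inl x.
Proof. by rewrite /axes_glue /=; case: pselect. Qed.

Lemma axes_glue_inr y : axes_glue (x0, y) = wedge_inr y.
Proof.
rewrite /axes_glue /=; case: pselect => //= ->; exact: wedge_inl_base.
Qed.

Lemma axes_glue_near_base (A : set Z) : nbhs (wedge_inl x0) A ->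
  \forall p \near ((x0, y0) : X * Y), on_axes p -> A (axes_glue p).
Proof.
move=> nA; exists (wedge_inl @^-1` A, wedge_inr @^-1` A).
  split; first exact: wedge_inl_continuous.
  by apply: wedge_inr_continuous; rewrite /= -wedge_inl_base.
move=> [x y] [/= Ax Ay] [/= ->|/= ->].
  by rewrite axes_glue_inr.
by rewrite axes_glue_inl.
Qed.

Lemma axes_glue_continuous (p : X * Y) (A : set Z) :
  open [set~ x0] -> open [set~ y0] -> on_axes p -> nbhs (axes_glue p) A ->
  \forall q \near p, on_axes q -> A (axes_glue q).
Proof.
case: p => x y ox oy; rewrite /on_axes /= => axy nA.
have [ex|nx] := pselect (x = x0); have [ey|ny] := pselect (y = y0).
- subst x y; apply: axes_glue_near_base; move: nA.
  by rewrite axes_glue_inl.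
- subst x; rewrite axes_glue_inr in nA.
  exists (setT, (wedge_inr @^-1` A) `&` [set~ y0]).
    split; first exact: filterT.
    apply: filterI; first exact: wedge_inr_continuous.
    exact: open_nbhs_nbhs.
  move=> [x' y'] [/= _ [Ay ny']] [/= ->|//].
  by rewrite axes_glue_inr.
- subst y; rewrite axes_glue_inl in nA.
  exists ((wedge_inl @^-1` A) `&` [set~ x0], setT).
    split; last exact: filterT.
    apply: filterI; first exact: wedge_inl_continuous.
    exact: open_nbhs_nbhs.
  move=> [x' y'] [/= [Ax nx'] _] [//|/= ->].
  by rewrite axes_glue_inl.
- by case: axy.
Qed.

End Wedge.

Arguments wedge_domain {X Y} x0 y0 U V.

(** * Planning motions in the wedge *)

Section WedgePlanner.
Context (R : realType) (X Y : topologicalType) (x0 : X) (y0 : Y).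
Local Notation Z := (wedge2 x0 y0).
Local Notation I := (unit_interval R).

Lemma near_fst (S T : topologicalType) (p : S * T) (Q : set S) :
  nbhs p.1 Q -> \forall q \near p, Q q.1.
Proof. by move=> nQ; exact: (cvg_fst (F := nbhs p.1) nQ). Qed.

(** The tube lemma for the compact unit interval. *)
Lemma near_all_times (T : topologicalType) (z : T) (Q : T * I -> Prop) :
  (forall t : I, \forall p \near (z, t), Q p) ->
  \forall w \near z, forall t, Q (w, t).
Proof.
move=> nQ.
suff : \forall w \near z, [set: I] `<=` [set t | Q (w, t)].
  by apply: filterS => w wQ t; exact: wQ.
have /compact_near_coveringP cI := @unit_interval_compact R.
apply: (cI T (nbhs z) (fun w t => Q (w, t))) => t _.
have [[A B] [/= nA nB] AB] := nQ t.
by exists (B, A) => // -[u w] [/= Bu Aw]; exact: AB.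
Qed.

Context (dX : X -> R) (dY : Y -> R).
Context (cdX : continuous dX) (cdY : continuous dY).
Context (dX_ge0 : forall x, 0 <= dX x) (dY_ge0 : forall y, 0 <= dY y).
Context (dX_eq0 : forall x, dX x = 0 <-> x = x0).
Context (dY_eq0 : forall y, dY y = 0 <-> y = y0).

Local Notation rX := (@retl X Y x0 y0).
Local Notation rY := (@retr X Y x0 y0).

(** With dX and dY measuring the distance to the base points, the delay is 0
    when the motion goes from X to Y and 1 when it goes from Y to X, except
    when both ends are the base point: then, and only then, the denominator
    vanishes. *)
Definition delay_num (zw : Z * Z) : R := dY (rY zw.1) + dX (rX zw.2).
Definition delay_den (zw : Z * Z) : R :=
  delay_num zw + (dX (rX zw.1) + dY (rY zw.2)).
Definition delay (zw : Z * Z) : R := delay_num zw / delay_den zw.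

Let delay_bounds zw : 0 <= delay zw <= 1.
Proof.
have n0 : 0 <= delay_num zw by rewrite addr_ge0.
have nd : delay_num zw <= delay_den zw by rewrite lerDl addr_ge0.
apply/andP; split; first by rewrite divr_ge0// (le_trans n0).
rewrite /delay; have [->|d0] := eqVneq (delay_den zw) 0.
  by rewrite invr0 mulr0.
by rewrite ler_pdivrMr ?mul1r// lt_neqAle eq_sym d0 (le_trans n0).
Qed.

Context (U : set (X * X)) (V : set (Y * Y)).
Context (FX : X * X * I -> X) (FY : Y * Y * I -> Y).
Context (oU : open U) (oV : open V).
Context (planX : forall z, U z -> planner_at FX z /\ reserved_at FX z).
Context (planY : forall z, V z -> planner_at FY z /\ reserved_at FY z).

Local Notation W := (wedge_domain x0 y0 U V).

(** Both reparametrizations run at double speed.  With delay 0 the motion in X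
    takes place in the first half of the time and the one in Y in the second
    half; with delay 1 it is the other way round. *)
Definition pathX (p : Z * Z * I) : X :=
  FX (retl2 p.1, clamp (2 * set_val p.2 - delay p.1)).
Definition pathY (p : Z * Z * I) : Y :=
  FY (retr2 p.1, clamp (2 * set_val p.2 - (1 - delay p.1))).
Definition wedge_planner (p : Z * Z * I) : Z :=
  axes_glue x0 y0 (pathX p, pathY p).

Lemma open_wedge_domain : open W.
Proof.
rewrite (_ : W = (@retl2 X Y x0 y0 @^-1` U) `&` (@retr2 X Y x0 y0 @^-1` V))//.
apply: openI; first by apply: open_comp => // z _; exact: retl2_continuous.
by apply: open_comp => // z _; exact: retr2_continuous.
Qed.

Let still_X p : W p.1 -> rX p.1.1 = rX p.1.2 -> pathX p = rX p.1.1.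
Proof. by move=> [Up _] e; rewrite /pathX; have [_ ->] := planX Up. Qed.

Let still_Y p : W p.1 -> rY p.1.1 = rY p.1.2 -> pathY p = rY p.1.1.
Proof. by move=> [_ Vp] e; rewrite /pathY; have [_ ->] := planY Vp. Qed.

(** If both ends are on the same axis then the other coordinate rests.  If not,
    one coordinate runs and reaches its base point before the other, which
    starts at its base point, begins to move. *)
Lemma wedge_planner_on_axes p : W p.1 -> on_axes x0 y0 (pathX p, pathY p).
Proof.
case: p => -[z w] t /= Wzw; rewrite /on_axes /=.
have [Uzw Vzw] := Wzw.
have [[_ FX0 FX1] _] := planX Uzw; have [[_ FY0 FY1] _] := planY Vzw.
have dx0 : dX x0 = 0 by apply/dX_eq0.
have dy0 : dY y0 = 0 by apply/dY_eq0.
have [[x ez]|[y ez]] := wedge_cases z; have [[x' ew]|[y' ew]] := wedge_cases w;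
  subst z w.
- by right; rewrite still_Y//= !retr_inl.
- have d0 : delay (wedge_inl x0 y0 x, wedge_inr x0 y0 y') = 0.
    by rewrite /delay /delay_num /= retr_inl retl_inr dx0 dy0 addr0 mul0r.
  have [t2|t2] := leP (2 * set_val t) 1.
    right; rewrite /pathY /= d0 clamp_le0 ?FY0/= ?retr_inl//.
    by rewrite subr0 subr_le0.
  left; rewrite /pathX /= d0 clamp_ge1 ?FX1/= ?retl_inr//.
  by rewrite subr0 ltW.
- have [dd|dd] := eqVneq (delay_den (wedge_inr x0 y0 y, wedge_inl x0 y0 x')) 0.
    right; rewrite still_Y//= ?retr_inr ?retr_inl.
      move: dd; rewrite /delay_den /delay_num /=.
      rewrite retr_inr retl_inl retl_inr retr_inl dx0 dy0 => dd.
      apply/dY_eq0; have := dY_ge0 y; have := dX_ge0 x'; lra.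
    move: dd; rewrite /delay_den /delay_num /=.
    rewrite retr_inr retl_inl retl_inr retr_inl dx0 dy0 => dd.
    apply/dY_eq0; have := dY_ge0 y; have := dX_ge0 x'; lra.
  have d1 : delay (wedge_inr x0 y0 y, wedge_inl x0 y0 x') = 1.
    rewrite /delay -[RHS](divff dd); congr (_ / _).
    by rewrite /delay_den /= retl_inr retr_inl dx0 dy0 !addr0.
  have [t2|t2] := leP (2 * set_val t) 1.
    left; rewrite /pathX /= d1 clamp_le0 ?FX0/= ?retl_inr//.
    by rewrite subr_le0.
  right; rewrite /pathY /= d1 clamp_ge1 ?FY1/= ?retr_inl//.
  by rewrite subrr subr0 ltW.
- by left; rewrite still_X//= !retl_inr.
Qed.

Let open_ne_x0 : open [set~ x0].
Proof.
rewrite (_ : [set~ x0] = [set x | 0 < dX x]); last first.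
  apply/seteqP; split => x /=.
    move=> nx; rewrite lt_neqAle dX_ge0 andbT eq_sym; apply/eqP => /dX_eq0.
    exact: nx.
  by move=> d0 /dX_eq0 e; rewrite e ltxx in d0.
exact: open_superlevel.
Qed.

Let open_ne_y0 : open [set~ y0].
Proof.
rewrite (_ : [set~ y0] = [set y | 0 < dY y]); last first.
  apply/seteqP; split => y /=.
    move=> ny; rewrite lt_neqAle dY_ge0 andbT eq_sym; apply/eqP => /dY_eq0.
    exact: ny.
  by move=> d0 /dY_eq0 e; rewrite e ltxx in d0.
exact: open_superlevel.
Qed.

Let near_W (p : Z * Z * I) : W p.1 -> \forall q \near p, W q.1.
Proof.
move=> Wp; apply: near_fst.
exact: (open_nbhs_nbhs (conj open_wedge_domain Wp)).
Qed.

Let continuous_of_paths (p : Z * Z * I) : W p.1 ->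
  continuous_at p pathX -> continuous_at p pathY ->
  continuous_at p wedge_planner.
Proof.
move=> Wp cX cY A nA.
have cp : continuous_at p (fun q => (pathX q, pathY q)).
  exact: continuous_pair_at.
have ax := wedge_planner_on_axes Wp.
have := axes_glue_continuous open_ne_x0 open_ne_y0 ax nA.
move=> /cp nax.
suff : \forall q \near p, A (wedge_planner q) by [].
have {}nax : \forall q \near p, on_axes x0 y0 (pathX q, pathY q) ->
  A (axes_glue x0 y0 (pathX q, pathY q)) by [].
by apply: filterS2 (near_W Wp) nax => q Wq; apply; exact: wedge_planner_on_axes.
Qed.

Let cdelay_num : continuous delay_num.
Proof.
move=> z; apply: cvgD.
  apply: continuous_comp; last exact: cdY.
  by apply: continuous_comp; [exact: cvg_fst|exact: retr_continuous].
apply: continuous_comp; last exact: cdX.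
by apply: continuous_comp; [exact: cvg_snd|exact: retl_continuous].
Qed.

Let cdelay_den : continuous delay_den.
Proof.
move=> z; apply: cvgD; first exact: cdelay_num.
apply: cvgD.
  apply: continuous_comp; last exact: cdX.
  by apply: continuous_comp; [exact: cvg_fst|exact: retl_continuous].
apply: continuous_comp; last exact: cdY.
by apply: continuous_comp; [exact: cvg_snd|exact: retr_continuous].
Qed.

Let continuous_reparam (T : topologicalType) (f : T -> R) (p : T * I) :
  continuous_at p.1 f ->
  continuous_at p (fun q => clamp (2 * set_val q.2 - f q.1)).
Proof.
move=> cf; apply: (@continuous_comp _ _ _
  (fun q : T * I => 2 * set_val q.2 - f q.1) (@clamp R));
  last exact: clamp_continuous.
apply: cvgB.
  apply: cvgM; first exact: cst_continuous.
  apply: continuous_comp; first exact: cvg_snd.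
  exact: unit_interval_val_continuous.
by apply: continuous_comp; [exact: cvg_fst|].
Qed.

Lemma wedge_planner_continuous_off_base (p : Z * Z * I) :
  W p.1 -> delay_den p.1 != 0 -> continuous_at p wedge_planner.
Proof.
move=> Wp dp; have [Up Vp] := Wp.
have cd : continuous_at p.1 delay.
  by apply: cvgM; [exact: cdelay_num|apply: cvgV; [|exact: cdelay_den]].
apply: continuous_of_paths => //.
  have [[cF _ _] _] := planX Up.
  apply: (@continuous_comp _ _ _ (fun q : Z * Z * I =>
    (retl2 q.1, clamp (2 * set_val q.2 - delay q.1))) FX); last exact: cF.
  apply: continuous_pair_at; last exact: continuous_reparam.
  by apply: continuous_comp; [exact: cvg_fst|exact: retl2_continuous].
have [[cF _ _] _] := planY Vp.
apply: (@continuous_comp _ _ _ (fun q : Z * Z * I =>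
  (retr2 q.1, clamp (2 * set_val q.2 - (1 - delay q.1)))) FY); last exact: cF.
apply: continuous_pair_at.
  by apply: continuous_comp; [exact: cvg_fst|exact: retr2_continuous].
apply: (@continuous_reparam _ (fun z => 1 - delay z)).
by apply: cvgB; [exact: cst_continuous|].
Qed.

(** Here the delay is discontinuous.  But the paths in X and Y rest at the base
    points, so by compactness of the unit interval the paths planned nearby
    stay close to the base points at all times, whatever their delays. *)
Lemma wedge_planner_continuous_at_base (p : Z * Z * I) :
  W p.1 -> delay_den p.1 = 0 -> continuous_at p wedge_planner.
Proof.
case: p => -[z w] t /= Wp dp A nA; have [Up Vp] := Wp.
have base : [/\ rX z = x0, rX w = x0, rY z = y0 & rY w = y0].
  move: dp; rewrite /delay_den /delay_num /=.
  have := dX_ge0 (rX z); have := dX_ge0 (rX w).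
  have := dY_ge0 (rY z); have := dY_ge0 (rY w) => h1 h2 h3 h4 h5.
  by split; [apply/dX_eq0|apply/dX_eq0|apply/dY_eq0|apply/dY_eq0]; lra.
have [z0 w0 z1 w1] := base.
have {}nA : nbhs (wedge_inl x0 y0 x0) A.
  move: nA; rewrite /wedge_planner still_X ?still_Y//= ?z0 ?z1 ?w0 ?w1//.
  by rewrite axes_glue_inl.
have [[A1 A2] /= [nA1 nA2] AA] := axes_glue_near_base nA.
have nX : \forall q \near (z, w), forall u, A1 (FX (retl2 q, u)).
  apply: (near_all_times (Q := fun q => A1 (FX (retl2 q.1, q.2)))) => u.
  have [[cF _ _] rF] := planX Up.
  have cu : continuous_at ((z, w), u)
      (fun q : Z * Z * I => FX (retl2 q.1, q.2)).
    apply: (@continuous_comp _ _ _ (fun q : Z * Z * I => (retl2 q.1, q.2)) FX).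
      apply: continuous_pair_at; last exact: cvg_snd.
      by apply: continuous_comp; [exact: cvg_fst|exact: retl2_continuous].
    exact: cF.
  by apply: (cu A1); rewrite /= rF /= ?z0 ?w0.
have nY : \forall q \near (z, w), forall u, A2 (FY (retr2 q, u)).
  apply: (near_all_times (Q := fun q => A2 (FY (retr2 q.1, q.2)))) => u.
  have [[cF _ _] rF] := planY Vp.
  have cu : continuous_at ((z, w), u)
      (fun q : Z * Z * I => FY (retr2 q.1, q.2)).
    apply: (@continuous_comp _ _ _ (fun q : Z * Z * I => (retr2 q.1, q.2)) FY).
      apply: continuous_pair_at; last exact: cvg_snd.
      by apply: continuous_comp; [exact: cvg_fst|exact: retr2_continuous].
    exact: cF.
  by apply: (cu A2); rewrite /= rF /= ?z1 ?w1.
suff : \forall q \near ((z, w), t), A (wedge_planner q) by [].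
have nXY : \forall q \near ((z, w), t),
    (forall u, A1 (FX (retl2 q.1, u))) /\ (forall u, A2 (FY (retr2 q.1, u))).
  exact: (near_fst (p := ((z, w), t)) (filterI nX nY)).
apply: filterS2 (near_W (p := ((z, w), t)) Wp) nXY => q Wq [qX qY].
apply: (AA (pathX q, pathY q)); last exact: wedge_planner_on_axes.
by split; [exact: qX|exact: qY].
Qed.

Lemma wedge_plannerP zw : W zw ->
  planner_at wedge_planner zw /\ reserved_at wedge_planner zw.
Proof.
move=> Wzw; have [Uzw Vzw] := Wzw.
have [[_ FX0 FX1] _] := planX Uzw; have [[_ FY0 FY1] _] := planY Vzw.
have /andP[d0 d1] := delay_bounds zw.
split; last first.
  case: zw Wzw {Uzw Vzw FX0 FX1 FY0 FY1 d0 d1} => z w Wzw.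
  rewrite /reserved_at /= => ezw t; subst w.
  by rewrite /wedge_planner still_X// still_Y//= axes_glueK.
split.
- move=> t; have [dd|dd] := eqVneq (delay_den zw) 0.
    exact: wedge_planner_continuous_at_base.
  exact: wedge_planner_continuous_off_base.
- rewrite /wedge_planner /pathX /pathY /=.
  rewrite !clamp_le0 ?FX0 ?FY0/= ?axes_glueK//; rewrite set_valE /=; lra.
- rewrite /wedge_planner /pathX /pathY /=.
  rewrite !clamp_ge1 ?FX1 ?FY1/= ?axes_glueK//; rewrite set_valE /=; lra.
Qed.

End WedgePlanner.

Arguments wedge_planner {R X Y} x0 y0 dX dY FX FY p.

(** * Covering numbers *)

Section CoveringNumbers.
Context (R : realType).
Implicit Types (T : topologicalType).

Definition has_cover T (P : set T -> Prop) (k : nat) : Prop :=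
  exists U : 'I_k -> set T,
    (forall i, open (U i) /\ P (U i)) /\ \bigcup_i U i = [set: T].

Lemma covering_number_le T (P : set T -> Prop) k :
  has_cover P k -> (covering_number R P <= k%:R%:E)%E.
Proof. by move=> cov; apply: ereal_inf_lbound; exists k. Qed.

Lemma covering_number_ge0 T (P : set T -> Prop) :
  (0 <= covering_number R P)%E.
Proof.
by apply: le_ereal_inf_tmp => _ [k _ <-]; rewrite lee_fin.
Qed.

Lemma covering_number_attained T (P : set T -> Prop) :
  covering_number R P = +oo%E \/
  exists2 k, has_cover P k & covering_number R P = k%:R%:E.
Proof.
have [[k0 cov0]|none] := pselect (exists k, has_cover P k); last first.
  left; rewrite /covering_number [X in ereal_inf X](_ : _ = set0) ?ereal_inf0//.
  by apply/seteqP; split=> // x [k cov _]; case: none; exists k.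
right; have ex : exists k, `[< has_cover P k >] by exists k0; apply/asboolP.
case: (ex_minnP ex) => k /asboolP cov mink; exists k => //.
apply/eqP; rewrite eq_le covering_number_le//=.
apply: le_ereal_inf_tmp => _ [l covl <-]; rewrite lee_fin ler_nat.
by apply: mink; apply/asboolP.
Qed.

Lemma covering_number_pullback T T' (P : set T -> Prop) (P' : set T' -> Prop)
    (f : T -> T') : continuous f ->
  (forall U, open U -> P' U -> P (f @^-1` U)) ->
  (covering_number R P <= covering_number R P')%E.
Proof.
move=> cf PP'; apply: le_ereal_inf_tmp => _ [k [U [oPU covU]] <-].
apply: covering_number_le; exists (fun i => f @^-1` U i); split.
  move=> i; have [oU PU] := oPU i; split; last exact: PP'.
  by apply: open_comp => // z _; exact: cf.
apply/seteqP; split => // z _; have : [set: T'] (f z) by [].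
by rewrite -covU => -[i _ Ui]; exists i.
Qed.

End CoveringNumbers.

(** * The lower bounds *)

Section LowerBounds.
Context (R : realType) (X Y : topologicalType) (x0 : X) (y0 : Y).
Local Notation Z := (wedge2 x0 y0).

Lemma TC_retract (A B : topologicalType) (i : A -> B) (r : B -> A) (a : A) :
  continuous i -> continuous r -> cancel i r -> (TC R A <= TC R B)%E.
Proof.
move=> ci cr ir.
pose ii (z : A * A) : B * B := (i z.1, i z.2).
have cii : continuous ii by exact: continuous_prod_map.
rewrite /TC; apply: (covering_number_pullback _ cii) => U oU [s ss].
have oiU : open (ii @^-1` U) by apply: open_comp => // z _; exact: cii.
have [|s' [ss' _]] := @planner_section R A a (ii @^-1` U)
  (fun p => r (s (ii p.1) p.2)) oiU; last by exists s'.
move=> z Uz; have [cs s0 s1] := section_planner oU ss Uz.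
split; [|by rewrite /= s0 ir|by rewrite /= s1 ir].
move=> t; apply: (@continuous_comp _ _ _ (fun p => s (ii p.1) p.2) r);
  last exact: cr.
apply: (@continuous_comp _ _ _
  (fun p : A * A * unit_interval R => (ii p.1, p.2))
  (fun p => s p.1 p.2)); last exact: cs.
apply: continuous_pair_at; last exact: cvg_snd.
by apply: continuous_comp; [exact: cvg_fst|exact: cii].
Qed.

(** Over the pairs (x, y), a path f planned in the wedge from x to y gives the
    homotopy that retracts f t to X and f (1 - t) to Y.  It ends at the
    retractions of y to X and of x to Y, which are the base points. *)
Lemma LScat_prod_le_TC_wedge : (LScat R (X * Y)%type <= TC R Z)%E.
Proof.
pose ij (p : X * Y) : Z * Z := (wedge_inl x0 y0 p.1, wedge_inr x0 y0 p.2).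
have cij : continuous ij.
  apply: continuous_prod_map.
    exact: wedge_inl_continuous.
  exact: wedge_inr_continuous.
rewrite /LScat /TC; apply: (covering_number_pullback _ cij) => U oU [s ss].
have oijU : open (ij @^-1` U) by apply: open_comp => // z _; exact: cij.
exists (x0, y0), (fun q =>
  (@retl X Y x0 y0 (s (ij q.1) q.2),
   @retr X Y x0 y0 (s (ij q.1) (reverse_time q.2)))); split.
  rewrite continuous_open_subspace; last first.
    rewrite (_ : _ `*` _ = (fst : _ * unit_interval R -> _) @^-1` (ij @^-1` U)).
      by apply: open_comp => // q _; exact: cvg_fst.
    by apply/seteqP; split => q //= [].
  move=> [p t] /set_mem [/= Up _]; have [cs _ _] := section_planner oU ss Up.
  apply: continuous_pair_at.
    apply: (@continuous_comp _ _ _ (fun q => s (ij q.1) q.2) (@retl X Y x0 y0));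
      last exact: retl_continuous.
    apply: (@continuous_comp _ _ _ (fun q : X * Y * unit_interval R =>
      (ij q.1, q.2)) (fun q => s q.1 q.2)); last exact: cs.
    apply: continuous_pair_at; last exact: cvg_snd.
    by apply: continuous_comp; [exact: cvg_fst|exact: cij].
  apply: (@continuous_comp _ _ _ (fun q => s (ij q.1) (reverse_time q.2))
    (@retr X Y x0 y0)); last exact: retr_continuous.
  apply: (@continuous_comp _ _ _ (fun q : X * Y * unit_interval R =>
    (ij q.1, reverse_time q.2)) (fun q => s q.1 q.2)); last exact: cs.
  apply: continuous_pair_at.
    by apply: continuous_comp; [exact: cvg_fst|exact: cij].
  by apply: continuous_comp; [exact: cvg_snd|exact: reverse_time_continuous].
move=> [x y] Uxy; have [_ s0 s1] := section_planner oU ss Uxy.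
rewrite /= reverse_time0 reverse_time1 s0 s1 /=.
by rewrite retl_inl retl_inr retr_inl retr_inr.
Qed.

End LowerBounds.

(** * The upper bound *)

Section UpperBound.
Context (R : realType).

Lemma pigeonhole_sum (N n m : nat) (P Q : 'I_N -> Prop) :
  (m <= \sum_(i < N) `[< P i >])%N -> (n <= \sum_(i < N) `[< Q i >])%N ->
  (N < n + m)%N -> exists i, P i /\ Q i.
Proof.
move=> Pm Qn Nnm; apply: contrapT => none.
have : (\sum_(i < N) (`[< P i >] + `[< Q i >]) <= \sum_(i < N) 1)%N.
  apply: leq_sum => i _; case: asboolP => Pi; case: asboolP => Qi //.
  by case: none; exists i.
rewrite big_split /= sum1_card card_ord => /(leq_trans (leq_add Pm Qn)).
by rewrite addnC leqNgt Nnm.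
Qed.

Lemma ENR_square_cozero (X : topologicalType) : ENR R X ->
  forall U : set (X * X), open U ->
  exists2 f : X * X -> R, continuous f & forall z, U z <-> 0 < f z.
Proof.
by move=> [n [e [emb _]]]; exact: (@embedding_square_cozero R X 'rV[R]_n e emb).
Qed.

Lemma ENR_base_distance (X : topologicalType) (x0 : X) : ENR R X ->
  exists d : X -> R,
    [/\ continuous d, forall x, 0 <= d x & forall x, d x = 0 <-> x = x0].
Proof.
by move=> [n [e [emb _]]];
  exact: (@embedding_base_distance R X 'rV[R]_n e x0 emb).
Qed.

Lemma reserved_multicover (X : topologicalType) (x0 : X) (n m : nat) :
  ENR R X ->
  has_cover (fun U => exists s : X * X -> path_space R X,
    section_over U s /\ reserved U s) n ->
  exists V, multicover (@has_reserved_planner R X) (x0, x0) (n + m) m.+1 V.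
Proof.
move=> enrX [U [oPU covU]].
pose U' (i : nat) : set (X * X) := if insub i is Some j then U j else set0.
have U'E (i : 'I_n) : U' i = U i by rewrite /U' valK.
apply: (@multicover_exists R _ _ (x0, x0) (@reserved_planner_glues R X)
  (ENR_square_cozero enrX) n U' m).
- move=> i ni; rewrite (U'E (Ordinal ni)); have [oU PU] := oPU (Ordinal ni).
  by split => //; exact: reserved_section_planner.
- move=> z; have : [set: X * X] z by [].
  by rewrite -covU => -[i _ Ui]; exists i; rewrite ?U'E.
Qed.

(** With N = n + m - 1, the cover of X * X is extended m - 1 times to reach
    multiplicity m, that of Y * Y is extended n - 1 times to reach n. *)
Lemma TCM_wedge_le (X Y : topologicalType) (x0 : X) (y0 : Y) :
  ENR R X -> ENR R Y ->
  (TCM R (wedge2 x0 y0) <= TCM R X + TCM R Y - 1)%E.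
Proof.
move=> enrX enrY; rewrite /(TCM R X) /(TCM R Y).
have Xge0 := covering_number_ge0 R (fun U : set (X * X) =>
  exists s : X * X -> path_space R X, section_over U s /\ reserved U s).
have Yge0 := covering_number_ge0 R (fun U : set (Y * Y) =>
  exists s : Y * Y -> path_space R Y, section_over U s /\ reserved U s).
have [Xoo|[n covX Xn]] := covering_number_attained R (fun U : set (X * X) =>
  exists s : X * X -> path_space R X, section_over U s /\ reserved U s).
  rewrite Xoo addye ?leey//.
  by rewrite -lteNye (lt_le_trans _ Yge0).
have [Yoo|[m covY Ym]] := covering_number_attained R (fun U : set (Y * Y) =>
  exists s : Y * Y -> path_space R Y, section_over U s /\ reserved U s).
  rewrite Yoo addey ?leey//.
  by rewrite -lteNye (lt_le_trans _ Xge0).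
have n0 : (0 < n)%N.
  move: covX => [U [_ covU]]; have : [set: X * X] (x0, x0) by [].
  by rewrite -covU => -[i _ _]; rewrite (leq_trans _ (ltn_ord i)).
have m0 : (0 < m)%N.
  move: covY => [U [_ covU]]; have : [set: Y * Y] (y0, y0) by [].
  by rewrite -covU => -[i _ _]; rewrite (leq_trans _ (ltn_ord i)).
rewrite Xn Ym.
have -> : (n%:R%:E + m%:R%:E - 1 = (n + m).-1%:R%:E :> \bar R)%E.
  rewrite -EFinD -natrD -[(n + m)%N in LHS]prednK ?addn_gt0 ?n0// -natr1.
  by rewrite addrK.
have [U [HU cU]] := reserved_multicover x0 m.-1 enrX covX.
have [V [HV cV]] := reserved_multicover y0 n.-1 enrY covY.
have eX : (n + m.-1)%N = (n + m).-1 by lia.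
have eY : (m + n.-1)%N = (n + m).-1 by lia.
rewrite {}eX prednK// in HU cU; rewrite {}eY prednK// in HV cV.
have [dX [cdX dX0 dXP]] := ENR_base_distance x0 enrX.
have [dY [cdY dY0 dYP]] := ENR_base_distance y0 enrY.
apply: covering_number_le.
exists (fun i => wedge_domain x0 y0 (U i) (V i)); split => [i|].
  have [oU [FX PX] _] := HU i (ltn_ord i).
  have [oV [FY PY] _] := HV i (ltn_ord i).
  have oW := open_wedge_domain (x0 := x0) (y0 := y0) oU oV; split => //.
  apply: (reserved_planner_section (wedge_inl x0 y0 x0)) => //.
  exists (wedge_planner x0 y0 dX dY FX FY) => zw [Uzw Vzw].
  exact: (wedge_plannerP cdX cdY dX0 dY0 dXP dYP oU oV PX PY).
apply/seteqP; split => // -[z w] _.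
have [|i [Ui Vi]] := pigeonhole_sum (cU (retl z, retl w)) (cV (retr z, retr w)).
  by rewrite prednK ?addn_gt0 ?n0.
by exists i.
Qed.

End UpperBound.

Local Open Scope ereal_scope.

Theorem theorem3p6 (R : realType) (X Y : topologicalType) (x0 : X) (y0 : Y)
    (hX : ENR R X) (hY : ENR R Y) :
  [/\ maxe (maxe (TC R X) (TC R Y)) (LScat R (X * Y)%type)
        <= TC R (wedge2 x0 y0),
      TC R (wedge2 x0 y0) <= TCM R (wedge2 x0 y0)
    & TCM R (wedge2 x0 y0) <= TCM R X + TCM R Y - 1].
Proof.
split; last exact: TCM_wedge_le.
- rewrite !ge_max; apply/andP; split; last exact: LScat_prod_le_TC_wedge.
  apply/andP; split.
    apply: (TC_retract _ x0 (@wedge_inl_continuous X Y x0 y0)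
      (@retl_continuous X Y x0 y0)).
    exact: retl_inl.
  apply: (TC_retract _ y0 (@wedge_inr_continuous X Y x0 y0)
    (@retr_continuous X Y x0 y0)).
  exact: retr_inr.
- rewrite /TC /TCM; apply: (covering_number_pullback _ (f := id)).
    by move=> z; exact: cvg_id.
  by move=> U _ [s [ss _]]; exists s.
Qed.
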